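(* Let $n\ge 1$ and let $\{p_k,U_k\}_{k=1}^M$ be a quantum encryption set for $n$ qubits, i.e. $p_k\ge 0$, $\sum_{k=1}^M p_k=1$, each $U_k$ is a $2^n\times 2^n$ unitary matrix, $$\sum_{k=1}^M p_k U_k\rho U_k^\dagger=\frac{1}{2^n}I\quad\text{for every } 2^n\times 2^n \text{ density matrix } \rho ,$$ and $$\sum_{k=1}^M p_k U_k X^\alpha Z^\beta U_k^\dagger=\delta_{\alpha,0}\delta_{\beta,0}I\quad\text{for all }\alpha,\beta\in\{0,1\}^n .$$ Then $$H(p_1,\dots,p_M)=\sum_{i=1}^M p_i\log_2\frac{1}{p_i}\ \ge\ 2n .$$ Additionally, if $M=2^{2n}$, then $p_k=\frac{1}{2^{2n}}$ for all $k$ and the matrices $U_k$ form an orthonormal basis of the space of $2^n\times 2^n$ complex matrices. Hence, given $M=2^{2n}$ nonnegative numbers $p_k$ with $\sum_k p_k=1$ and $2^n\times 2^n$ unitary matrices $U_k$, the set $\{p_k,U_k\}_{k=1}^{2^{2n}}$ is a quantum encryption set if and only if the $U_k$ form an orthonormal basis of the space of $2^n\times 2^n$ complex matrices and $p_k=\frac{1}{2^{2n}}$ for all $k$.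
   Context: A density matrix is a positive semidefinite matrix of trace $1$. With $\sigma_x=\begin{pmatrix}0&1\\1&0\end{pmatrix}$ and $\sigma_z=\begin{pmatrix}1&0\\0&-1\end{pmatrix}$, for $\alpha,\beta\in\{0,1\}^n$ put $X^\alpha=\bigotimes_{i=1}^n\sigma_x^{\alpha(i)}$ and $Z^\beta=\bigotimes_{i=1}^n\sigma_z^{\beta(i)}$. Orthonormality of $2^n\times 2^n$ matrices is with respect to the normalized trace inner product $\langle M_1,M_2\rangle=\frac{1}{2^n}\mathrm{Tr}(M_1M_2^\dagger)$. The convention $0\log_2\frac10=0$ is used. *)

(* Defs.v *)
From mathcomp Require Import all_boot all_order all_algebra.
From mathcomp Require Import sesquilinear spectral.
From mathcomp Require Import complex mxtens.
From mathcomp Require Import reals exp.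

Set Implicit Arguments.
Unset Strict Implicit.
Unset Printing Implicit Defensive.

Import Order.TTheory GRing.Theory Num.Theory.
Local Open Scope ring_scope.
Local Open Scope sesquilinear_scope.
Local Open Scope complex_scope.

(* [0 <= z] in [R[i]] means that [z] is real and nonnegative. *)
Definition psdmx (R : realType) (m : nat) (A : 'M[R[i]]_m) : Prop :=
  A \is hermsymmx /\ forall v : 'cV[R[i]]_m, 0 <= (v^t* *m A *m v) 0 0.

Definition density_matrix (R : realType) (m : nat) (rho : 'M[R[i]]_m) : Prop :=
  psdmx rho /\ \tr rho = 1.

(* [A 0 *t (A 1 *t ... )]; the cast is along [2 * 2 ^ n = 2 ^ n.+1]. *)
Fixpoint bigtens (C : pzRingType) (n : nat) :
    ('I_n -> 'M[C]_2) -> 'M[C]_(2 ^ n) :=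
  if n is n'.+1 return ('I_n -> 'M[C]_2) -> 'M[C]_(2 ^ n) then
    fun A => castmx (esym (expnS 2 n'), esym (expnS 2 n'))
               (A ord0 *t bigtens (fun i => A (lift ord0 i)))
  else fun _ => 1%:M.

Definition sigma_x (R : realType) : 'M[R[i]]_2 :=
  \matrix_(i, j) (i != j)%:R.

Definition sigma_z (R : realType) : 'M[R[i]]_2 :=
  \matrix_(i, j) (if i == j then (-1) ^+ i else 0).

Definition bits (n : nat) := {ffun 'I_n -> bool}.

Definition zero_bits (n : nat) : bits n := [ffun=> false].

Definition Xop (R : realType) (n : nat) (alpha : bits n) : 'M[R[i]]_(2 ^ n) :=
  bigtens (fun i => sigma_x R ^+ alpha i).

Definition Zop (R : realType) (n : nat) (beta : bits n) : 'M[R[i]]_(2 ^ n) :=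
  bigtens (fun i => sigma_z R ^+ beta i).

Record quantum_encryption_set (R : realType) (n M : nat)
    (p : 'I_M -> R) (U : 'I_M -> 'M[R[i]]_(2 ^ n)) : Prop := {
  qes_ge0 : forall k, 0 <= p k;
  qes_sum : \sum_k p k = 1;
  qes_unitary : forall k, U k \is unitarymx;
  qes_density : forall rho : 'M[R[i]]_(2 ^ n), density_matrix rho ->
    \sum_k (p k)%:C *: (U k *m rho *m (U k)^t*) = ((2 ^ n)%:R^-1)%:M;
  qes_pauli : forall alpha beta : bits n,
    \sum_k (p k)%:C *: (U k *m (Xop R alpha *m Zop R beta) *m (U k)^t*)
    = ((alpha == zero_bits n)%:R * (beta == zero_bits n)%:R)%:M
}.

Definition log2 (R : realType) (x : R) : R := ln x / ln 2.

(* The convention for [p i = 0] holds because the factor [p i] vanishes. *)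
Definition entropy (R : realType) (M : nat) (p : 'I_M -> R) : R :=
  \sum_i p i * log2 (1 / p i).

Definition mxinner (R : realType) (n : nat) (A B : 'M[R[i]]_(2 ^ n)) : R[i] :=
  (2 ^ n)%:R^-1 * \tr (A *m B^t*).

Definition orthonormal_basis (R : realType) (n M : nat)
    (U : 'I_M -> 'M[R[i]]_(2 ^ n)) : Prop :=
  (forall j k, mxinner (U j) (U k) = (j == k)%:R) /\
  basis_of {: 'M[R[i]]_(2 ^ n)} [seq U k | k <- enum 'I_M].

(* Main.v *)
(* Applied to the rank-one projections, the encryption condition forces, by
   polarization, sum_k p_k U_k A U_k^* = (tr A / 2^n) I for every matrix A.
   Equivalently, the M x 4^n matrix W whose k-th row is the vectorization of
   sqrt(2^n p_k) U_k satisfies W^* W = I.  Then the Gram matrix G = W W^* is a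
   projection, so sum_l |G_kl|^2 = G_kk = 4^n p_k, whence p_k <= 4^-n, which
   bounds the entropy term by term.  If M = 4^n, all these inequalities are
   equalities, and G = I says that the U_k are orthonormal.  Conversely, for
   orthonormal U_k and p_k = 4^-n the matrix W is square with W W^* = I, hence
   W^* W = I. *)
Require Import Defs.
From HB Require Import structures.
From mathcomp Require Import all_boot all_order all_algebra.
From mathcomp Require Import sesquilinear spectral.
From mathcomp Require Import complex mxtens.
From mathcomp Require Import reals exp.
From mathcomp Require Import ring.

Import Order.TTheory GRing.Theory Num.Theory.
Local Open Scope ring_scope.
Local Open Scope complex_scope.
Local Open Scope sesquilinear_scope.

Set Implicit Arguments.
Unset Strict Implicit.
Unset Printing Implicit Defensive.

(** * Isometries, Gram matrices and extremal sums *)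

Lemma conjT_mul (C : numClosedFieldType) r s t
    (A : 'M[C]_(r, s)) (B : 'M[C]_(s, t)) :
  (A *m B)^t* = B^t* *m A^t*.
Proof. by rewrite trmx_mul map_mxM. Qed.

(** The sizes are kept apart because the use is at [M] and [m * m], which are only provably
    equal. *)
Lemma mulmx1C_eq (F : comPzRingType) r s (A : 'M[F]_(r, s)) (B : 'M_(s, r)) :
  r = s -> A *m B = 1%:M -> B *m A = 1%:M.
Proof. by move=> rs; case: _ / rs in A B *; apply: mulmx1C. Qed.

(** The Gram matrix is Hermitian, and [W^t* *m W] cancels inside its square; compare diagonals. *)
Lemma isometry_gram_sqr (C : numClosedFieldType) r s (W : 'M[C]_(r, s)) :
  W^t* *m W = 1%:M ->
  forall k, \sum_l `|(W *m W^t*) k l| ^+ 2 = (W *m W^t*) k k.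
Proof.
move=> isoW k; transitivity (((W *m W^t*) *m (W *m W^t*)^t*) k k).
  by rewrite [RHS]mxE; apply: eq_bigr => l _; rewrite normCK !mxE.
by rewrite conjT_mul trmxCK mulmxA -[W *m _ *m W]mulmxA isoW mulmx1.
Qed.

(** The nonnegative gaps [M%:R^-1 - p k] sum to zero, so each vanishes. *)
Lemma eq_inv_of_sum1 (F : numFieldType) M (p : 'I_M -> F) :
  \sum_k p k = 1 -> (forall k, p k <= M%:R^-1) -> forall k, p k = M%:R^-1.
Proof.
move=> sum1 p_le k; have M_neq0 : M%:R != 0 :> F.
  by rewrite pnatr_eq0 -lt0n (leq_ltn_trans _ (ltn_ord k)).
apply/eqP; rewrite eq_sym -subr_eq0; apply/eqP.
apply: (psumr_eq0P (P := xpredT) (F := fun k => M%:R^-1 - p k)) => //.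
  by move=> l _; rewrite subr_ge0.
by rewrite sumrB sum1 sumr_const card_ord -[_^-1 *+ _]mulr_natr mulVf // subrr.
Qed.

(** * Twirling, depolarizing and the vectorization matrix *)

Section Twirl.
Variables (C : numClosedFieldType) (m : nat).

(* Polarization: [v + w] gives [f (v w^* ) + f (w v^* ) = 0], and [v + i w]
   gives [f (v w^* ) - f (w v^* ) = 0]. *)
Lemma linear_eq0_outer (V : lmodType C) (f : {linear 'M[C]_m -> V}) :
  (forall v : 'cV[C]_m, f (v *m v^t*) = 0) -> forall A, f A = 0.
Proof.
move=> f0 A.
have fvw (v w : 'cV[C]_m) : f (v *m w^t*) = 0.
  have f1 : f (v *m w^t*) + f (w *m v^t*) = 0.
    have := f0 (v + w).
    by rewrite linearD map_mxD /= mulmxDl !mulmxDr !linearD /= !f0 add0r addr0.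
  have f2 : f (v *m w^t*) - f (w *m v^t*) = 0.
    have := f0 (v + 'i *: w).
    rewrite linearD linearZ map_mxD map_mxZ /= conjCi mulmxDl !mulmxDr.
    rewrite -!scalemxAr -!scalemxAl !linearD !linearZ /= !f0.
    rewrite !scaler0 add0r addr0.
    (* The cross terms carry coefficients [-'i] and ['i]; this turns them into [1] and [-1]. *)
    move/(congr1 ( *:%R 'i)).
    rewrite scalerDr !scalerA mulrN -expr2 sqrCi opprK.
    by rewrite scale1r scaleN1r scaler0.
  have : f (v *m w^t*) *+ 2 = 0.
    by rewrite mulr2n -[RHS]addr0 -{1}f1 -f2 addrACA subrr addr0.
  by rewrite -scaler_nat => /eqP; rewrite scaler_eq0 pnatr_eq0 => /eqP.
rewrite (matrix_sum_delta A) linear_sum big1 // => i _.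
rewrite linear_sum big1 // => j _; rewrite linearZ /=.
have -> : delta_mx i j = delta_mx i 0 *m (delta_mx j 0 : 'cV[C]_m)^t*.
  by rewrite trmx_delta map_delta_mx mul_delta_mx.
by rewrite fvw scaler0.
Qed.

Variable M : nat.
Implicit Types (q : 'I_M -> C) (U : 'I_M -> 'M[C]_m).

Definition twirl q U (A : 'M[C]_m) : 'M[C]_m :=
  \sum_k q k *: (U k *m A *m (U k)^t*).

Lemma twirl_is_linear q U : linear (twirl q U).
Proof.
move=> a A B; rewrite /twirl scaler_sumr -big_split; apply: eq_bigr => k _ /=.
by rewrite mulmxDr mulmxDl -scalemxAr -scalemxAl scalerDr !scalerA mulrC.
Qed.

HB.instance Definition _ q U :=
  GRing.isLinear.Build C 'M[C]_m 'M[C]_m *:%R (twirl q U) (twirl_is_linear q U).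

Definition depolarize (A : 'M[C]_m) : 'M[C]_m := (\tr A / m%:R)%:M.

Lemma depolarize_is_linear : linear depolarize.
Proof.
move=> a A B; rewrite /depolarize linearD linearZ /= mulrDl raddfD /=.
by rewrite -mulrA scale_scalar_mx.
Qed.

HB.instance Definition _ :=
  GRing.isLinear.Build C 'M[C]_m 'M[C]_m *:%R depolarize depolarize_is_linear.

Lemma twirl_eq_outer q U :
  (forall v : 'cV[C]_m, twirl q U (v *m v^t*) = depolarize (v *m v^t*)) ->
  forall A, twirl q U A = depolarize A.
Proof.
move=> eq_vv A; apply/eqP; rewrite -subr_eq0; apply/eqP.
apply: (linear_eq0_outer (f := twirl q U \- depolarize)) => v /=.
by rewrite eq_vv subrr.
Qed.

Lemma twirl_delta q U i j a b :
  twirl q U (delta_mx i j) a b = \sum_k q k * (U k a i * (U k b j)^*).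
Proof.
rewrite summxE; apply: eq_bigr => k _; rewrite mxE -(mul_delta_mx (0 : 'I_1)).
by rewrite mulmxA -mulmxA -colE -rowE mxE big_ord1 !mxE.
Qed.

(* The columns are indexed by the matrix entries: row [k] is the vectorization
   of [sqrt (q k * m) U k], so that twirling is depolarizing iff the columns
   are orthonormal, while the Gram matrix of the rows is that of the [U k]. *)
Definition vecmx q U : 'M[C]_(M, m * m) :=
  \matrix_k (sqrtC (q k * m%:R) *: mxvec (U k)).

Lemma vecmxE q U k a i :
  vecmx q U k (mxvec_index a i) = sqrtC (q k * m%:R) * U k a i.
Proof. by rewrite !mxE mxvecE. Qed.

Lemma vecmx_gram q U k l : (vecmx q U *m (vecmx q U)^t*) k l =
  sqrtC (q k * m%:R) * (sqrtC (q l * m%:R))^* * \tr (U k *m (U l)^t*).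
Proof.
transitivity (\sum_a \sum_i
    vecmx q U k (mxvec_index a i) * (vecmx q U l (mxvec_index a i))^*).
  rewrite mxE (reindex _ (curry_mxvec_bij m m)) pair_bigA /=.
  by apply: eq_bigr => -[a i] _; rewrite !mxE.
rewrite mulr_sumr; apply: eq_bigr => a _.
rewrite mxE mulr_sumr; apply: eq_bigr => i _.
by rewrite !vecmxE !mxE rmorphM mulrACA.
Qed.

(** The adjoint conjugates the entry at [(a, i)], which therefore supplies the conjugated factor in
    [twirl_delta]; hence the order [j i] and [b a]. *)
Lemma vecmx_colgram q U (q_ge0 : forall k, 0 <= q k) a i b j :
  ((vecmx q U)^t* *m vecmx q U) (mxvec_index a i) (mxvec_index b j) =
  m%:R * twirl q U (delta_mx j i) b a.
Proof.
rewrite twirl_delta mxE mulr_sumr; apply: eq_bigr => k _.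
have qm_ge0 : 0 <= q k * m%:R by rewrite mulr_ge0.
rewrite mxE [X in X^* * _]mxE !vecmxE rmorphM /= geC0_conj ?sqrtC_ge0 //.
by rewrite mulrACA -expr2 sqrtCK; ring.
Qed.

Lemma depolarize_delta a i b j :
  m%:R * depolarize (delta_mx j i) b a =
  (1%:M : 'M[C]_(m * m)) (mxvec_index a i) (mxvec_index b j).
Proof.
have m_neq0 : m%:R != 0 :> C.
  by rewrite pnatr_eq0 -lt0n (leq_ltn_trans _ (ltn_ord a)).
rewrite /depolarize; have -> : \tr (delta_mx j i : 'M[C]_m) = (i == j)%:R.
  by rewrite -(mul_delta_mx (0 : 'I_1)) mxtrace_mulC mul_delta_mx_cond
    trace_mx11 mulmxnE mxE.
rewrite !mxE mulrnAr mulrCA divff // mulr1 -mulr_natr -natrM mulnb andbC.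
by rewrite (inj_eq (@cast_ord_inj _ _ _)) (inj_eq enum_rank_inj)
  xpair_eqE eq_sym.
Qed.

(** Entrywise, the isometry equation compares the two maps on matrix units, which span. *)
Lemma vecmx_isometryP q U (q_ge0 : forall k, 0 <= q k) (m_gt0 : (0 < m)%N) :
  (vecmx q U)^t* *m vecmx q U = 1%:M <->
  (forall A, twirl q U A = depolarize A).
Proof.
have m_neq0 : m%:R != 0 :> C by rewrite pnatr_eq0 -lt0n.
split=> [isoW A | eq_tw].
  rewrite (matrix_sum_delta A) !linear_sum; apply: eq_bigr => j _.
  rewrite !linear_sum; apply: eq_bigr => i _; rewrite !linearZ; congr (_ *: _).
  apply/matrixP=> b a; apply: (mulfI m_neq0).
  by rewrite -vecmx_colgram // isoW depolarize_delta.
apply/matrixP=> x y.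
case/mxvec_indexP: x => a i; case/mxvec_indexP: y => b j.
by rewrite vecmx_colgram // eq_tw depolarize_delta.
Qed.

Lemma vecmx_gram_diag q U k (qk_ge0 : 0 <= q k) (Uk : U k \is unitarymx) :
  (vecmx q U *m (vecmx q U)^t*) k k = q k * (m * m)%:R.
Proof.
have qm_ge0 : 0 <= q k * m%:R by rewrite mulr_ge0.
rewrite vecmx_gram geC0_conj ?sqrtC_ge0 // -expr2 sqrtCK.
by rewrite (unitarymxP Uk) mxtrace1 natrM mulrA.
Qed.

(** The diagonal entry [g] of the Gram matrix is one term of its own row sum, so [g ^+ 2 <= g]. *)
Lemma twirl_weight_le q U k (q_ge0 : forall k, 0 <= q k)
    (m_gt0 : (0 < m)%N) (Uk : U k \is unitarymx) :
  (forall A, twirl q U A = depolarize A) -> q k * (m * m)%:R <= 1.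
Proof.
move=> /(vecmx_isometryP U q_ge0 m_gt0)/isometry_gram_sqr/(_ k).
rewrite (bigD1 k) //= (vecmx_gram_diag (q_ge0 k) Uk); set g := q k * _ => sum_g.
have g_ge0 : 0 <= g by rewrite mulr_ge0.
have: g ^+ 2 <= g.
  rewrite -[leRHS]sum_g ger0_norm // lerDl sumr_ge0 //.
  by move=> l _; rewrite exprn_ge0.
have [->//|g_neq0] := eqVneq g 0.
by rewrite expr2 ger_pMr // lt_def g_neq0.
Qed.

(** The diagonal term already exhausts the row sum, so off-diagonal Gram entries vanish; nonzero
    weights let the square roots be cancelled. *)
Lemma twirl_orthogonal q U k l (q_ge0 : forall k, 0 <= q k)
    (m_gt0 : (0 < m)%N) (Uk : U k \is unitarymx) :
  (forall A, twirl q U A = depolarize A) ->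
  q k * (m * m)%:R = 1 -> q l != 0 -> k != l -> \tr (U k *m (U l)^t*) = 0.
Proof.
move=> tw qk1 ql_neq0 kl.
have qk_neq0 : q k != 0.
  by apply/eqP=> qk0; move/eqP: qk1; rewrite qk0 mul0r eq_sym oner_eq0.
have m_neq0 : m%:R != 0 :> C by rewrite pnatr_eq0 -lt0n.
have /isometry_gram_sqr/(_ k) := (vecmx_isometryP U q_ge0 m_gt0).2 tw.
rewrite (bigD1 k) //= (vecmx_gram_diag (q_ge0 k) Uk) qk1 normr1 expr1n.
move/eqP; rewrite -subr_eq0 addrAC subrr add0r => /eqP/psumr_eq0P.
move=> /(_ (fun _ _ => exprn_ge0 _ (normr_ge0 _)) l); rewrite eq_sym kl.
move=> /(_ isT)/eqP; rewrite sqrf_eq0 normr_eq0 vecmx_gram !mulf_eq0 conjC_eq0.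
by rewrite !sqrtC_eq0 !mulf_eq0 (negPf qk_neq0) (negPf ql_neq0)
  (negPf m_neq0) => /eqP.
Qed.

Lemma twirl_of_orthonormal U (m_gt0 : (0 < m)%N) : M = (m * m)%N ->
  (forall k l, m%:R^-1 * \tr (U k *m (U l)^t*) = (k == l)%:R) ->
  forall A, twirl (fun=> (m * m)%:R^-1) U A = depolarize A.
Proof.
move=> Mmm orthU; have m_neq0 : m%:R != 0 :> C by rewrite pnatr_eq0 -lt0n.
apply/vecmx_isometryP => //; first by move=> _; rewrite invr_ge0.
apply: mulmx1C_eq => //; apply/matrixP=> k l.
(* The equal row scalars multiply to [m / m ^ 2], the normalization of the trace inner product. *)
rewrite vecmx_gram -normCK ger0_norm ?sqrtC_ge0 ?mulr_ge0 ?invr_ge0 // sqrtCK.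
by rewrite natrM invfM mulfVK // orthU mxE.
Qed.

Lemma orthonormal_free U :
  (forall k l, m%:R^-1 * \tr (U k *m (U l)^t*) = (k == l)%:R) ->
  free [seq U k | k <- enum 'I_M].
Proof.
move=> orthU; apply/(@freeP _ _ _ (map_tuple U (ord_tuple M))) => c sum0 l.
have nthU (k : 'I_M) : (map_tuple U (ord_tuple M))`_k = U k.
  by rewrite -tnth_nth tnth_map tnth_ord_tuple.
(* Pairing the vanishing combination with [U l] isolates [c l]. *)
have := congr1 (fun A => m%:R^-1 * \tr (A *m (U l)^t*)) sum0.
rewrite /= mul0mx linear0 mulr0 mulmx_suml linear_sum mulr_sumr /=.
rewrite (bigD1 l) //=.
rewrite big1 => [|k kl].
  by rewrite nthU -scalemxAl linearZ mulrCA orthU eqxx mulr1 addr0.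
by rewrite nthU -scalemxAl linearZ /= mulrCA orthU (negPf kl) mulr0.
Qed.

End Twirl.

(** * Traces of tensor products and Pauli operators *)

Lemma mulmx_castmx (F : pzRingType) r s (e : r = s) (A B : 'M[F]_r) :
  castmx (e, e) A *m castmx (e, e) B = castmx (e, e) (A *m B).
Proof. by case: _ / e. Qed.

Lemma mxtrace_castmx (F : nmodType) r s (e : r = s) (A : 'M[F]_r) :
  \tr (castmx (e, e) A) = \tr A.
Proof. by case: _ / e. Qed.

Lemma mxtrace_tens (F : pzRingType) r s (A : 'M[F]_r) (B : 'M[F]_s) :
  \tr (A *t B) = \tr A * \tr B.
Proof. by rewrite /mxtrace mulr_sum; apply: eq_bigr => i _; rewrite mxE. Qed.

Lemma mxtrace_bigtens_mul (F : comPzRingType) n (A B : 'I_n -> 'M[F]_2) :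
  \tr (bigtens A *m bigtens B) = \prod_i \tr (A i *m B i).
Proof.
elim: n A B => [|n IHn] A B; first by rewrite big_ord0 mulmx1 mxtrace1.
by rewrite /= mulmx_castmx mxtrace_castmx tensmx_mul mxtrace_tens IHn
   big_ord_recl.
Qed.

Section Pauli.
Variable R : realType.

Lemma mxtrace_sigma (a b : bool) :
  \tr (sigma_x R ^+ a *m sigma_z R ^+ b) = (2 * (~~ a && ~~ b))%:R.
Proof.
case: a; case: b; rewrite /= ?expr0 ?expr1 ?mulmx1 ?mul1mx /mxtrace;
  rewrite !big_ord_recl big_ord0 !mxE ?big_ord_recl ?big_ord0 ?mxE /= /bump /=;
  by rewrite ?muln0 ?muln1; ring.
Qed.

(** This makes the Pauli condition the value of [depolarize] at a Pauli operator. *)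
Lemma mxtrace_pauli n (alpha beta : bits n) :
  \tr (Xop R alpha *m Zop R beta) =
  (2 ^ n)%:R * ((alpha == zero_bits n)%:R * (beta == zero_bits n)%:R).
Proof.
rewrite mxtrace_bigtens_mul; under eq_bigr do rewrite mxtrace_sigma.
rewrite -[in RHS]natrM mulnb.
case: (boolP (_ && _)) => [/andP[/eqP-> /eqP->]|nz].
  by under eq_bigr do rewrite !ffunE; rewrite prodr_const card_ord natrX mulr1.
(* A single nonzero bit yields a traceless factor, which kills the product. *)
have [i nzi] : exists i, alpha i || beta i.
  apply/existsP; apply: contraR nz; rewrite negb_exists => /forallP ab0.
  by apply/andP; split; apply/eqP/ffunP=> i; have := ab0 i; rewrite ffunE;
    case: (alpha i); case: (beta i).
by rewrite mulr0 (bigD1 i) //= -negb_or nzi muln0 mul0r.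
Qed.

End Pauli.

(** * Encryption sets, entropy and the extremal case *)

Section Encryption.
Variables (R : realType) (n : nat).

Lemma psdmx_outer m (c : R[i]) (v : 'cV[R[i]]_m) : 0 <= c ->
  psdmx (c *: (v *m v^t*)).
Proof.
move=> c_ge0; split.
  apply/is_hermitianmxP; rewrite expr0 scale1r linearZ map_mxZ /=.
  by rewrite geC0_conj // conjT_mul trmxCK.
move=> w; rewrite -scalemxAr -scalemxAl mxE mulr_ge0 //.
have -> : w^t* *m (v *m v^t*) *m w = (v^t* *m w)^t* *m (v^t* *m w).
  by rewrite conjT_mul trmxCK !mulmxA.
by rewrite mxE big_ord1 !mxE mulrC mul_conjC_ge0.
Qed.

(** A nonzero [v *m v^t*] divided by its trace is a density matrix; scaling back gives all outer
    products, and polarization the rest. *)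
Lemma qes_twirl M (p : 'I_M -> R) (U : 'I_M -> 'M[R[i]]_(2 ^ n)) :
  quantum_encryption_set p U ->
  forall A, twirl (fun k => (p k)%:C) U A = depolarize A.
Proof.
move=> qes; apply: twirl_eq_outer => v.
set c := \tr (v *m v^t*).
have cE : c = \sum_i `|v i 0| ^+ 2.
  rewrite /c /mxtrace; apply: eq_bigr => i _.
  by rewrite mxE big_ord1 !mxE normCK.
(* As [c] is the squared norm of [v], it vanishes only for [v = 0]. *)
have [c0|c_neq0] := eqVneq c 0.
  have -> : v = 0.
    apply/colP => i; rewrite mxE; apply/eqP; rewrite -normr_eq0 -sqrf_eq0.
    apply/eqP; move: c0; rewrite cE => /psumr_eq0P; apply => // j _.
    exact: exprn_ge0.
  by rewrite mul0mx !linear0.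
have c_ge0 : 0 <= c by rewrite cE sumr_ge0 // => i _; rewrite exprn_ge0.
have /(qes_density qes) : density_matrix (c^-1 *: (v *m v^t*)).
  by split; [apply: psdmx_outer; rewrite invr_ge0 | rewrite linearZ /= mulVf].
rewrite -/(twirl _ _ _) linearZ /= => /(congr1 ( *:%R c)).
by rewrite scalerA divff // scale1r scale_scalar_mx.
Qed.

Lemma twirl_qes M (p : 'I_M -> R) (U : 'I_M -> 'M[R[i]]_(2 ^ n)) :
  (forall k, 0 <= p k) -> \sum_k p k = 1 -> (forall k, U k \is unitarymx) ->
  (forall A, twirl (fun k => (p k)%:C) U A = depolarize A) ->
  quantum_encryption_set p U.
Proof.
move=> p_ge0 p_sum Uu tw; split=> // [rho [_ tr1]|alpha beta].
  by rewrite -/(twirl _ _ _) tw /depolarize tr1 div1r.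
rewrite -/(twirl _ _ _) tw /depolarize mxtrace_pauli mulrC mulKf //.
by rewrite pnatr_eq0 -lt0n expn_gt0.
Qed.

(** Write [N%:R] as the [p]-average of itself and compare termwise: [1 / p k] is at least [2 ^ N]
    where [p k] is nonzero. *)
Lemma entropy_ge M (p : 'I_M -> R) N :
  (forall k, 0 <= p k) -> \sum_k p k = 1 -> (forall k, p k <= (2 ^ N)%:R^-1) ->
  N%:R <= entropy p.
Proof.
move=> p_ge0 p_sum p_le; rewrite -[leLHS]mul1r -{1}p_sum mulr_suml.
apply: ler_sum => k _; have [->|pk_neq0] := eqVneq (p k) 0.
  by rewrite !mul0r.
have pk_gt0 : 0 < p k by rewrite lt_def pk_neq0 p_ge0.
have ln2_gt0 : 0 < ln 2 :> R by rewrite ln_gt0 // ltr1n.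
rewrite ler_pM2l // /log2 ler_pdivlMr // mulr_natl -lnXn // div1r -natrX.
rewrite ler_ln ?posrE ?invr_gt0 // ?ltr0n ?expn_gt0 //.
by rewrite -[leLHS]invrK lef_pV2 ?posrE ?invr_gt0 ?ltr0n ?expn_gt0.
Qed.

Lemma sqr_pow2 : (2 ^ n * 2 ^ n = 2 ^ (2 * n))%N.
Proof. by rewrite -expnD mul2n addnn. Qed.

Lemma qes_weight_le M (p : 'I_M -> R) (U : 'I_M -> 'M[R[i]]_(2 ^ n)) :
  quantum_encryption_set p U -> forall k, p k <= (2 ^ (2 * n))%:R^-1.
Proof.
move=> qes k; have pC_ge0 l : 0 <= (p l)%:C by rewrite ler0c (qes_ge0 qes).
have := twirl_weight_le pC_ge0 (expn_gt0 2 n) (qes_unitary qes k)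
  (qes_twirl qes).
(* The bound lives in [R[i]]; both sides are images of reals, so it descends to [R]. *)
rewrite sqr_pow2 -[_%:R](rmorph_nat (real_complex R)) -rmorphM lecR.
by rewrite -ler_pdivlMr ?ltr0n ?expn_gt0 // div1r.
Qed.

Lemma qes_extremal M (p : 'I_M -> R) (U : 'I_M -> 'M[R[i]]_(2 ^ n)) :
  quantum_encryption_set p U -> M = (2 ^ (2 * n))%N ->
  (forall k, p k = 1 / (2 ^ (2 * n))%:R) /\ orthonormal_basis U.
Proof.
move=> qes Mn; have pE k : p k = (2 ^ (2 * n))%:R^-1.
  rewrite -Mn; apply: eq_inv_of_sum1 (qes_sum qes) _ k => l.
  by rewrite Mn; apply: qes_weight_le qes l.
split=> [k|]; first by rewrite pE div1r.
have m_neq0 : (2 ^ n)%:R != 0 :> R[i] by rewrite pnatr_eq0 -lt0n expn_gt0.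
have pC_ge0 l : 0 <= (p l)%:C by rewrite ler0c (qes_ge0 qes).
have pC k : (p k)%:C = (2 ^ (2 * n))%:R^-1 by rewrite pE fmorphV rmorph_nat.
have mm_neq0 : (2 ^ (2 * n))%:R != 0 :> R[i].
  by rewrite pnatr_eq0 -lt0n expn_gt0.
have orthU k l : mxinner (U k) (U l) = (k == l)%:R.
  have [<-|kl] := eqVneq k l.
    by rewrite /mxinner (unitarymxP (qes_unitary qes k)) mxtrace1 mulVf.
  rewrite /mxinner (twirl_orthogonal pC_ge0 (expn_gt0 2 n) (qes_unitary qes k)
    (qes_twirl qes) _ _ kl) ?mulr0 //= pC ?invr_eq0 //.
  by rewrite sqr_pow2 mulVf.
(* An orthonormal family is free, and its size [M] equals the dimension [2 ^ n * 2 ^ n]. *)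
split=> //; rewrite basisEfree orthonormal_free // subvf /=.
by rewrite dimvf size_map size_enum_ord Mn -sqr_pow2.
Qed.

End Encryption.

Theorem theorem6p3 (R : realType) (n : nat) (hn : (1 <= n)%N) :
  (forall (M : nat) (p : 'I_M -> R) (U : 'I_M -> 'M[R[i]]_(2 ^ n)),
     quantum_encryption_set p U ->
     entropy p >= (2 * n)%:R /\
     (M = (2 ^ (2 * n))%N ->
        (forall k, p k = 1 / (2 ^ (2 * n))%:R) /\ orthonormal_basis U)) /\
  (forall (p : 'I_(2 ^ (2 * n)) -> R)
          (U : 'I_(2 ^ (2 * n)) -> 'M[R[i]]_(2 ^ n)),
     (forall k, 0 <= p k) -> \sum_k p k = 1 ->
     (forall k, U k \is unitarymx) ->
     (quantum_encryption_set p U <->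
      orthonormal_basis U /\ (forall k, p k = 1 / (2 ^ (2 * n))%:R))).
Proof.
split=> [M p U qes | p U p_ge0 p_sum Uu].
  split; last exact: qes_extremal qes.
  exact: entropy_ge (qes_ge0 qes) (qes_sum qes) (qes_weight_le qes).
split=> [qes | [[orthU _] pE]].
  by have [] := qes_extremal qes erefl.
apply: twirl_qes => // A.
rewrite -(twirl_of_orthonormal (expn_gt0 2 n) (esym (sqr_pow2 n)) orthU).
rewrite /twirl; apply: eq_bigr => k _; congr (_ *: _).
by rewrite pE div1r sqr_pow2 fmorphV rmorph_nat.
Qed.
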